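(* Let $T>0$, let $\Omega$ be the torus $[0,1]$ (periodic boundary conditions), let $K=K(t,x)\ge 0$, and let $K'=\kappa K$ for some constant $\kappa>0$. Let $u_{obs}$ solve $$\partial_t u_{obs}+u_{obs}\,\partial_x u_{obs}=0,\qquad u_{obs}|_{x=0}=u_{obs}|_{x=1},\qquad \partial_x u_{obs}|_{x=0}=\partial_x u_{obs}|_{x=1}$$ on $[0,T]\times\Omega$ with some initial condition $u_{obs}|_{t=0}=u_{obs}^0$. Consider the coupled forward-backward problem $$(F)\quad \partial_t u+u\,\partial_x u=-K(u-u_{obs}),\qquad u|_{x=0}=u|_{x=1},\quad \partial_x u|_{x=0}=\partial_x u|_{x=1},\qquad u|_{t=0}=u_0,$$ $$(B)\quad \partial_t\tilde u+\tilde u\,\partial_x\tilde u=K'(\tilde u-u_{obs}),\qquad \tilde u|_{x=0}=\tilde u|_{x=1},\quad \partial_x\tilde u|_{x=0}=\partial_x\tilde u|_{x=1},\qquad \tilde u|_{t=T}=u(T),$$ where $T$ is such that there is no shock in the interval $[0,T]$. Set $w(t)=u(t)-u_{obs}(t)$ and $\tilde w(t)=\tilde u(t)-u_{obs}(t)$. Assume that $u_{obs}\in W^{1,\infty}([0,T]\times\Omega)$, and let $M>0$ be such that $$|\partial_x u_{obs}(t,x)|\le M\qquad\text{for all } t\in[0,T],\ x\in\Omega.$$ Then, with $\|\cdot\|$ the $L^2(\Omega)$ norm: 1. If $K(t,x)=K$ is constant (so $K'=\kappa K$ is constant), then for all $t\in[0,T]$, $$\|\tilde w(t)\|\le e^{(-K-K'+M)(T-t)}\,\|w(t)\|.$$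 2. If $K(t,x)=K\,\mathbf 1_{[t_1,t_2]}(t)$ with a constant $K>0$ and $0\le t_1<t_2\le T$ (so that $K'(t,x)=K'\,\mathbf 1_{[t_1,t_2]}(t)$ with the constant $K'=\kappa K$), then $$\|\tilde w(0)\|\le e^{(-K-K')(t_2-t_1)+MT}\,\|w(0)\|.$$
   Context: The problem $(F)$-$(B)$ is one step of the ''back and forth nudging'' (BFN) algorithm for the inviscid Bürgers' equation: the forward equation $(F)$ is solved on $[0,T]$ from the initial condition $u_0$, and the backward equation $(B)$ is solved on $[0,T]$ from the final condition $\tilde u(T)=u(T)$. The pair $(u,\tilde u)$ denotes the solution of $(F)$-$(B)$; ''no shock in $[0,T]$'' means that the solutions remain regular (no discontinuity forms) on $[0,T]$. The function $K$ is the nudging gain and $\mathbf 1_I$ denotes the indicator function of the interval $I$. *)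

(* Defs.v *)
From HB Require Import structures.
From mathcomp Require Import all_boot all_order all_algebra.
From mathcomp Require Import all_classical all_reals all_analysis.

Set Implicit Arguments.
Unset Strict Implicit.
Unset Printing Implicit Defensive.

Import Order.TTheory GRing.Theory Num.Theory.
Import numFieldNormedType.Exports.

Local Open Scope classical_set_scope.
Local Open Scope ring_scope.

(* A function u on [0, T] x Omega is represented by u : R -> R -> R, with u t x
   its value at time t and position x; its values outside [0, T] x [0, 1] are
   irrelevant. Only test functions are genuine functions on R x R. *)

Section burgers.
Context {R : realType}.
Implicit Types (T t x l : R) (f : R -> R) (u phi : R -> R -> R).

Definition cylinder T : set (R * R) := `[0, T] `*` `[0, 1].

Local Notation lebesgue2 := (@lebesgue_measure R \x @lebesgue_measure R)%E.

(* f has derivative l at a relative to A: two-sided at the interior points of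
   an interval A, one-sided at its endpoints. *)
Definition is_derive_within (A : set R) f (a l : R) : Prop :=
  (f y - f a) / (y - a) @[y --> within A a^'] --> l.

Definition is_dt T u t x l : Prop := is_derive_within `[0, T] (u^~ x) t l.

Definition is_dx u t x l : Prop := is_derive_within `[0, 1] (u t) x l.

Definition periodic_bc T u : Prop :=
  forall t : R, t \in `[0, T] ->
    u t 0 = u t 1 /\ exists l, is_dx u t 0 l /\ is_dx u t 1 l.

(* Regular (shock-free) solution on [0, T] x Omega of u_t + u u_x = src.
   Regularity is Lipschitz continuity in (t, x), and the equation holds almost
   everywhere: when src jumps in time, u_t jumps too, so that the equation
   cannot be required at every time. *)
Definition burgers_solution T (src : R -> R -> R) u : Prop :=
  [/\ [lipschitz u p.1 p.2 | p in cylinder T],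
      periodic_bc T u &
      {ae lebesgue2, forall p : R * R, cylinder T p ->
        exists ut ux, [/\ is_dt T u p.1 p.2 ut, is_dx u p.1 p.2 ux &
          ut + u p.1 p.2 * ux = src p.1 p.2]}].

Definition partial_t phi : R -> R -> R := fun t x => derive1 (phi^~ x) t.

Definition partial_x phi : R -> R -> R := fun t x => derive1 (phi t) x.

Fixpoint continuously_diff (n : nat) phi : Prop :=
  continuous (fun p : R * R => phi p.1 p.2) /\
  match n with
  | 0 => True
  | m.+1 =>
      [/\ forall t x, derivable (phi^~ x) t 1 /\ derivable (phi t) x 1,
          continuously_diff m (partial_t phi) &
          continuously_diff m (partial_x phi)]
  end.

(* Smooth functions with compact support in ]0, T[ x Omega; as Omega is the
   torus, this means 1-periodicity in x and a support condition on t only. *)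
Definition test_function T phi : Prop :=
  [/\ forall n, continuously_diff n phi,
      forall t x, phi t (x + 1) = phi t x &
      exists a b : R, [/\ 0 < a, b < T &
        forall t x, t \notin `[a, b] -> phi t x = 0]].

Definition Linfty T u : Prop :=
  ((fun p : R * R => u p.1 p.2) \_ (cylinder T)) \in Lfun lebesgue2 +oo%E.

Definition W1infty T u : Prop :=
  Linfty T u /\
  exists gt gx : R -> R -> R,
    [/\ Linfty T gt, Linfty T gx &
      forall phi, test_function T phi ->
        \int[lebesgue2]_(p in cylinder T) (u p.1 p.2 * partial_t phi p.1 p.2) =
          - (\int[lebesgue2]_(p in cylinder T) (gt p.1 p.2 * phi p.1 p.2)) /\
        \int[lebesgue2]_(p in cylinder T) (u p.1 p.2 * partial_x phi p.1 p.2) =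
          - (\int[lebesgue2]_(p in cylinder T) (gx p.1 p.2 * phi p.1 p.2))].

Definition L2norm f : \bar R :=
  'N[@lebesgue_measure R]_2%:E[EFin \o (f \_ `[0, 1])%R]%E.

End burgers.

(* Main.v *)
Require Import Defs.
From HB Require Import structures.
From mathcomp Require Import all_boot all_order all_algebra.
From mathcomp Require Import all_classical all_reals all_analysis.
From mathcomp Require Import measurable_realfun.
From mathcomp Require Import ring lra.

Set Implicit Arguments.
Unset Strict Implicit.
Unset Printing Implicit Defensive.

Import Order.TTheory GRing.Theory Num.Theory.
Import numFieldNormedType.Exports.

Local Open Scope classical_set_scope.
Local Open Scope ring_scope.

(** The proof is an energy estimate.  Let v be u or util, o = uobs, w = v - o,
    and let c (v - o) be the source term of v.  Subtracting the two equations
    and multiplying by 2 w gives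

      (w^2)_t + (2/3 w^3 + o w^2)_x = (2 c - o_x) w^2.

    The x-flux is periodic, so it integrates to zero over the torus and
    E(t) = int w(t,x)^2 dx satisfies (2 c - M) E <= E' <= (2 c + M) E, because
    |o_x| <= M.  For u, with c = -K, the upper bound carries E from t to T; for
    util, with c = K', the lower bound controls E(t) by E(T).  The two errors
    agree at time T, so multiplying the two growth factors and taking square
    roots gives the first claim.  In the second one, c vanishes outside [t1, t2],
    and the same estimates are chained over [0, t1], [t1, t2] and [t2, T].

    The functions are only Lipschitz and the equations hold only almost
    everywhere, so E' cannot be computed by differentiating under the integral.
    Multiplying the identity by a weight e(t) = exp(- lam t), lam = 2 c + M or
    2 c - M, turns each differential inequality for E into P_t + Q_x <= 0 almost
    everywhere (up to an overall sign), with P = e w^2 and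
    Q = e (2/3 w^3 + o w^2) Lipschitz, and what is needed is divergence_le: then
    int P(t,x) dx is nonincreasing in t.  Its proof integrates the sum D_h of the
    difference quotients of P in t and of Q in x over a rectangle.  The integral
    of D_h telescopes in each variable (integral_difference_quotient), so it is
    int P(b,x) dx - int P(a,x) dx up to O(h).  On the other hand D_h is uniformly
    bounded and converges almost everywhere to P_t + Q_x <= 0, so the integral
    of its positive part tends to 0 by dominated convergence. *)

(** * Integrals of Lipschitz functions *)

Section lipschitz_integrals.
Context {R : realType}.
Implicit Types (a b c L h t s x y : R) (P Q : R -> R -> R).
Local Notation mu := (@lebesgue_measure R).

(** A joint Lipschitz bound makes P the supremum, over rational points q, of the
    cones P q - L |p - q|; hence a superlevel set of P is a countable union of
    superlevel sets of such cones. *)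
Lemma measurable_lipschitz2 P L :
  (forall t s x y, `|P t x - P s y| <= L * (`|t - s| + `|x - y|)) ->
  measurable_fun [set: measurableTypeR R * measurableTypeR R]
    (fun p => P p.1 p.2).
Proof.
move=> lipP.
have L0 : 0 <= L.
  have := lipP 1 0 0 0; rewrite !subr0 normr1 normr0 addr0 mulr1.
  exact: le_trans.
move=> mT; apply: (measurability _ (RGenOInfty.measurableE R)) => //.
move=> /= _ [_ [c ->] <-]; rewrite setTI.
rewrite [X in measurable X](_ : _ = \bigcup_(q : rat) \bigcup_(r : rat)
  [set p : measurableTypeR R * measurableTypeR R |
    c < P (ratr q) (ratr r) - L * (`|p.1 - ratr q| + `|p.2 - ratr r|)]).
  apply: bigcupT_measurable_rat => q; apply: bigcupT_measurable_rat => r.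
  pose cone (p : measurableTypeR R * measurableTypeR R) : R :=
    P (ratr q) (ratr r) - L * (`|p.1 - ratr q| + `|p.2 - ratr r|).
  rewrite -[X in measurable X]setTI.
  rewrite [X in measurable (_ `&` X)](_ : _ = cone @^-1` `]c, +oo[%classic);
    last by rewrite preimage_itvoy.
  suff mf : measurable_fun setT cone by apply: mf => //; exact: measurable_itv.
  apply: measurable_funB => //; apply: measurable_funM => //.
  apply: measurable_funD; apply: measurableT_comp => //;
    apply: measurable_funB => //.
apply/seteqP; split => [[t x]|[t x] [q _ [r _]]] /=; rewrite in_itv/= andbT.
  move=> cP.
  (* A rational point at distance at most e in each variable loses at most
     4 L e < P t x - c. *)
  pose e : R := (P t x - c) / (4 * (L + 1)).
  have L4 : 0 < 4 * (L + 1) by rewrite mulr_gt0// ltr_wpDl.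
  have e0 : (0 : R) < e by rewrite divr_gt0 ?subr_gt0.
  have eE : e * (4 * (L + 1)) = P t x - c by rewrite divfK// gt_eqF.
  have [q /itvP tq] := rat_in_itvoo (ltr_pwDr e0 (lexx (t : R))).
  have [r /itvP xr] := rat_in_itvoo (ltr_pwDr e0 (lexx (x : R))).
  exists q => //; exists r => //=.
  have tqe : `|t - ratr q| <= e :> R.
    by rewrite distrC ger0_norm ?lerBlDl ?subr_ge0// tq.
  have xre : `|x - ratr r| <= e :> R.
    by rewrite distrC ger0_norm ?lerBlDl ?subr_ge0// xr.
  have H1 := le_trans (ler_norm _) (lipP t (ratr q) x (ratr r)).
  have H2 := ler_wpM2l L0 (lerD tqe xre).
  have arith (S p d u : R) : u - p <= S -> S <= L * (d + d) -> 0 < d ->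
    d * (4 * (L + 1)) = u - c -> c < p - S by nra.
  exact: arith H1 H2 e0 eE.
move/lt_le_trans; apply; rewrite lerBlDr -lerBlDl.
rewrite (le_trans (ler_norm _))// (le_trans (lipP _ _ _ _))//.
by rewrite distrC (distrC x).
Qed.

Lemma integral_shift (f : R -> R) a b h : a <= b -> continuous f ->
  \int[mu]_(t in `[a, b]) f (t + h) = \int[mu]_(t in `[a + h, b + h]) f t.
Proof.
move=> ab cf; rewrite /Rintegral; congr fine; apply/esym.
have dE : derive1 (fun t : R => t + h) = cst 1.
  apply/funext => x; rewrite derive1E deriveD// derive_id derive_cst addr0//.
rewrite (@integration_by_substitution_increasing R (fun t => t + h) f) //.
- by apply: eq_integral => x _ /=; rewrite dE /= mulr1.
- by move=> x y _ _; rewrite ltrD2r.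
- by rewrite dE => x _; exact: cvg_cst.
- by rewrite dE; exact: is_cvg_cst.
- by rewrite dE; exact: is_cvg_cst.
- split.
  + by move=> x _; exact: derivableD.
  + by apply: cvg_at_right_filter; apply: cvgD; [exact: cvg_id|exact: cvg_cst].
  + by apply: cvg_at_left_filter; apply: cvgD; [exact: cvg_id|exact: cvg_cst].
- exact: continuous_subspaceT.
Qed.

Lemma continuous_lipschitz1 (f : R -> R) L :
  (forall x y, `|f x - f y| <= L * `|x - y|) -> continuous f.
Proof.
move=> lipf x; apply/cvgrPdist_le => e e0.
have L0 : 0 <= L.
  by have := lipf 1 0; rewrite subr0 normr1 mulr1; exact: le_trans.
near=> y; rewrite (le_trans (lipf _ _))//.
rewrite (@le_trans _ _ ((L + 1) * `|x - y|)) ?ler_wpM2r ?lerDl//.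
rewrite -ler_pdivlMl ?ltr_wpDl//.
near: y; apply: cvgr_dist_le; first exact: cvg_id.
by rewrite mulr_gt0// invr_gt0 ltr_wpDl.
Unshelve. all: by end_near. Qed.

Lemma continuous_integrable_itv (f : R -> R) a b : continuous f ->
  mu.-integrable `[a, b] (EFin \o f).
Proof.
move=> cf; apply: continuous_compact_integrable; first exact: segment_compact.
exact: continuous_subspaceT.
Qed.

Lemma Rintegral_cst_itv a b c : a <= b ->
  \int[mu]_(t in `[a, b]) c = c * (b - a).
Proof.
move=> ab; rewrite Rintegral_cst//= lebesgue_measure_itv/= lte_fin.
case: ltP => //= ba; congr (c * _).
by rewrite (@le_anti _ _ a b) ?ab// subrr.
Qed.

Lemma Rintegral_itv_cat (f : R -> R) a b c : a <= b -> b <= c -> continuous f ->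
  \int[mu]_(t in `[a, c]) f t =
  \int[mu]_(t in `[a, b]) f t + \int[mu]_(t in `[b, c]) f t.
Proof.
move=> ab bc cf.
have := @Rintegral_itvB R f (BLeft a) (BRight c) b
  (@continuous_integrable_itv _ _ _ cf).
rewrite !bnd_simp => /(_ ab bc) /eqP; rewrite subr_eq addrC => /eqP ->.
rewrite Rintegral_itv_obnd_cbnd//.
apply: (integrableS _ _ _ (@continuous_integrable_itv _ b c cf)) => //.
by apply: subset_itvr; rewrite bnd_simp.
Qed.

Lemma integral_short_interval (f : R -> R) L a h : 0 <= h ->
  (forall x y, `|f x - f y| <= L * `|x - y|) ->
  `|\int[mu]_(t in `[a, a + h]) f t - f a * h| <= L * h * h.
Proof.
move=> h0 lipf; have cf := continuous_lipschitz1 lipf.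
have L0 : 0 <= L.
  by have := lipf 1 0; rewrite subr0 normr1 mulr1; exact: le_trans.
have ah : a <= a + h by rewrite lerDl.
have cstE c : c * h = \int[mu]_(t in `[a, a + h]) c.
  by rewrite Rintegral_cst_itv// addrAC subrr add0r.
have ic c : mu.-integrable `[a, a + h] (EFin \o cst c).
  by apply: continuous_integrable_itv => x; exact: cvg_cst.
have bnd t : t \in `[a, a + h] -> `|f t - f a| <= L * h.
  move=> /itvP tah; rewrite (le_trans (lipf _ _))// ler_wpM2l//.
  by rewrite ger0_norm ?subr_ge0 ?tah// lerBlDl tah.
have lo : (f a - L * h) * h <= \int[mu]_(t in `[a, a + h]) f t.
  rewrite cstE; apply: le_Rintegral => //; first exact: ic.
    exact: continuous_integrable_itv.
  by move=> t /= /bnd; rewrite ler_norml => /andP[]; lra.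
have hi : \int[mu]_(t in `[a, a + h]) f t <= (f a + L * h) * h.
  rewrite cstE; apply: le_Rintegral => //;
    [exact: continuous_integrable_itv|exact: ic|].
  by move=> t /= /bnd; rewrite ler_norml => /andP[]; lra.
by rewrite ler_norml; lra.
Qed.

(** The integral of the quotient is the mean of f over [b, b + h] minus its mean
    over [a, a + h], and each mean is within L h of the value at the left end. *)
Lemma integral_difference_quotient (f : R -> R) L a b h : a <= b -> 0 < h ->
  (forall x y, `|f x - f y| <= L * `|x - y|) ->
  f b - f a - 2 * L * h <= \int[mu]_(t in `[a, b]) ((f (t + h) - f t) / h).
Proof.
move=> ab h0 lipf; have cf := continuous_lipschitz1 lipf.
have cfh : continuous (fun t => f (t + h)).
  move=> x; apply: (@continuous_comp _ _ _ (fun t => t + h) f); last exact: cf.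
  by apply: continuousD; [exact: cvg_id|exact: cvg_cst].
have cd : continuous (fun t => f (t + h) - f t).
  by move=> x; apply: cvgB; [exact: cfh|exact: cf].
rewrite RintegralZr//; last exact: continuous_integrable_itv.
rewrite RintegralB//; try exact: continuous_integrable_itv.
rewrite integral_shift// ler_pdivlMr//.
have H1 : \int[mu]_(t in `[a, b + h]) f t =
    \int[mu]_(t in `[a, a + h]) f t + \int[mu]_(t in `[a + h, b + h]) f t.
  by apply: Rintegral_itv_cat => //; rewrite ?lerD2r// lerDl ltW.
have H2 : \int[mu]_(t in `[a, b + h]) f t =
    \int[mu]_(t in `[a, b]) f t + \int[mu]_(t in `[b, b + h]) f t.
  by apply: Rintegral_itv_cat => //; rewrite lerDl ltW.
have := integral_short_interval a (ltW h0) lipf.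
have := integral_short_interval b (ltW h0) lipf.
rewrite !ler_norml => /andP[+ _] /andP[_ +].
by move: H1 H2; do 5 move: (Rintegral _ _ _) => ?; lra.
Qed.

End lipschitz_integrals.

(** * Bounded functions on rectangles *)

Section rectangles.
Context {R : realType}.
Implicit Types (a b c L h t s x y : R) (P Q F : R -> R -> R).
Local Notation mu := (@lebesgue_measure R).
Local Notation lebesgue2 := (@lebesgue_measure R \x @lebesgue_measure R)%E.

Section fubini_rectangle.
Variables (A B : set (measurableTypeR R)) (F : R -> R -> R) (C : R).
Hypotheses (mA : measurable A) (mB : measurable B).
Hypotheses (finA : (mu A < +oo)%E) (finB : (mu B < +oo)%E).
Hypothesis mF : measurable_fun [set: measurableTypeR R * measurableTypeR R]
  (fun p => F p.1 p.2).
Hypothesis bF : forall t x, `|F t x| <= C.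

Lemma bounded_integrable2 :
  lebesgue2.-integrable (A `*` B) (EFin \o (fun p => F p.1 p.2)).
Proof.
apply: measurable_bounded_integrable; first exact: measurableX.
- rewrite [ltLHS](_ : _ = (mu A * mu B)%E); last exact: product_measure1E.
  by rewrite lte_mul_pinfty// ge0_fin_numE.
- exact: measurable_funTS.
- exists C; split; first exact: num_real.
  by move=> M CM p _ /=; rewrite (le_trans (bF _ _))// ltW.
Qed.

Lemma bounded_integrable_snd t : mu.-integrable B (EFin \o F t).
Proof.
apply: measurable_bounded_integrable => //.
- apply: measurable_funTS; exact: (measurableT_comp mF (measurable_pair1 t)).
- exists C; split; first exact: num_real.
  by move=> M CM p _ /=; rewrite (le_trans (bF _ _))// ltW.
Qed.

Lemma bounded_integrable_fst x : mu.-integrable A (EFin \o F^~ x).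
Proof.
apply: measurable_bounded_integrable => //.
- apply: measurable_funTS; exact: (measurableT_comp mF (measurable_pair2 x)).
- exists C; split; first exact: num_real.
  by move=> M CM p _ /=; rewrite (le_trans (bF _ _))// ltW.
Qed.

Let FAB : measurableTypeR R * measurableTypeR R -> \bar R :=
  (EFin \o (fun p => F p.1 p.2)) \_ (A `*` B).

Let iFAB : lebesgue2.-integrable setT FAB.
Proof.
apply/(integrable_restrict _ _ _ _).1 => //; first exact: measurableX.
by rewrite setTI; exact: bounded_integrable2.
Qed.

Let fubini_FE :
  fubini_F mu FAB = (EFin \o (fun t => \int[mu]_(x in B) F t x)) \_ A.
Proof.
apply/funext => t; rewrite /fubini_F patchE /Rintegral; case: ifPn => tA.
  rewrite /= fineK; last exact: integrable_fin_num (bounded_integrable_snd t).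
  rewrite [RHS]integral_mkcond; apply: eq_integral => x _.
  by rewrite /FAB !patchE in_setX tA /=; case: ifPn.
rewrite integral0_eq// => x _.
by rewrite /FAB !patchE in_setX (negbTE tA).
Qed.

Let fubini_GE :
  fubini_G mu FAB = (EFin \o (fun x => \int[mu]_(t in A) F t x)) \_ B.
Proof.
apply/funext => x; rewrite /fubini_G patchE /Rintegral; case: ifPn => xB.
  rewrite /= fineK; last exact: integrable_fin_num (bounded_integrable_fst x).
  rewrite [RHS]integral_mkcond; apply: eq_integral => t _.
  by rewrite /FAB !patchE in_setX xB andbT /=; case: ifPn.
rewrite integral0_eq// => t _.
by rewrite /FAB !patchE in_setX (negbTE xB) andbF.
Qed.

Lemma integrable_Rintegral_fst :
  mu.-integrable B (EFin \o (fun x => \int[mu]_(t in A) F t x)).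
Proof.
have mG : measurable_fun B (EFin \o (fun x => \int[mu]_(t in A) F t x)).
  have := measurable_fubini_G iFAB; rewrite fubini_GE.
  by move/(measurable_restrictT _ mB).2.
apply: measurable_bounded_integrable => //; first exact/measurable_EFinP.
exists (C * fine (mu A)); split; first exact: num_real.
move=> M CM x _ /=; rewrite (le_trans _ (ltW CM))//.
rewrite (le_trans (le_normr_Rintegral _ (bounded_integrable_fst x)))//.
rewrite -Rintegral_cst//; apply: le_Rintegral => //.
- exact: integrable_norm (bounded_integrable_fst x).
- apply: (@measurable_bounded_integrable _ _ _ mu (cst C)) => //.
  exact: bounded_cst.
Qed.

Lemma integrable_Rintegral_snd :
  mu.-integrable A (EFin \o (fun t => \int[mu]_(x in B) F t x)).
Proof.
have := integrable_fubini_F iFAB; rewrite fubini_FE.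
by move/(integrable_restrict _ _ _ _).2; rewrite setTI; exact.
Qed.

Lemma Fubini_rectangle :
  Rintegral lebesgue2 (A `*` B) (fun p => F p.1 p.2) =
  \int[mu]_(t in A) \int[mu]_(x in B) F t x.
Proof.
rewrite /Rintegral; congr fine.
rewrite integral_mkcond -integral12_prod_meas1// fubini_FE.
by rewrite [RHS]integral_mkcond.
Qed.

Lemma Fubini_rectangle_swap :
  Rintegral lebesgue2 (A `*` B) (fun p => F p.1 p.2) =
  \int[mu]_(x in B) \int[mu]_(t in A) F t x.
Proof.
rewrite /Rintegral; congr fine.
rewrite integral_mkcond -integral21_prod_meas1// fubini_GE.
by rewrite [RHS]integral_mkcond.
Qed.

End fubini_rectangle.

Lemma Rintegral_itv_cc_oo (f : R -> R) a b : continuous f ->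
  \int[mu]_(t in `]a, b[) f t = \int[mu]_(t in `[a, b]) f t.
Proof.
move=> cf; rewrite /Rintegral [in RHS]integral_itv_bndoo//.
suff : measurable_fun `]a, b[ (EFin \o f) by [].
apply/measurable_EFinP; apply: measurable_funTS.
exact: continuous_measurable_fun.
Qed.

Lemma continuous_integrable_itvoo (f : R -> R) a b : continuous f ->
  mu.-integrable `]a, b[ (EFin \o f).
Proof.
move=> cf.
apply: (integrableS _ _ _ (@continuous_integrable_itv _ _ a b cf)) => //.
exact: subset_itv_oo_cc.
Qed.

End rectangles.

(** * Right derivatives *)

Section right_derivatives.
Context {R : realType}.
Implicit Types (c d h t s x y l m : R) (f g : R -> R).

(** Difference quotients with a positive step suffice for the almost everywhere
    arguments, and at interior points they do not depend on the interval to which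
    a derivative is relative. *)
Definition has_right_deriv (f : R -> R) (x l : R) : Prop :=
  (f (x + h) - f x) / h @[h --> 0^'+] --> l.

Lemma has_right_deriv_within f c d x l : c <= x -> x < d ->
  is_derive_within `[c, d] f x l -> has_right_deriv f x l.
Proof.
move=> cx xd H; rewrite /has_right_deriv.
have shift : x + h @[h --> 0^'+] --> within `[c, d] x^'.
  move=> A /=; rewrite /within /= => -[e /= e0 He].
  have m0 : 0 < Num.min e (d - x) by rewrite lt_min e0 subr_gt0.
  exists (Num.min e (d - x)) => // h /=.
  rewrite sub0r normrN lt_min => /andP[he hd] h0.
  have hh := gtr0_norm h0; rewrite hh in he hd.
  apply: He => /=.
  - by rewrite opprD addrA subrr sub0r normrN hh.
  - by rewrite -subr_eq0 addrAC subrr add0r gt_eqF.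
  - by rewrite in_itv/=; apply/andP; split; lra.
have := cvg_comp _ _ shift H.
apply: cvg_trans; apply: near_eq_cvg; apply: nearW => h /=.
by rewrite [_ + _ - x]addrAC subrr add0r.
Qed.

Lemma has_right_deriv_eq f g d x l : x < d ->
  (forall y, x <= y < d -> f y = g y) ->
  has_right_deriv f x l -> has_right_deriv g x l.
Proof.
move=> xd fg; apply: cvg_trans; apply: near_eq_cvg; near=> h.
rewrite !fg ?lexx//.
apply/andP; split; first by rewrite lerDl ltW.
by rewrite -ltrBrDl; near: h; apply: nbhs_right_lt; rewrite subr_gt0.
Unshelve. all: by end_near. Qed.

Lemma has_right_deriv_cst c x : has_right_deriv (fun=> c) x 0.
Proof.
rewrite /has_right_deriv subrr; under eq_fun do rewrite mul0r.
exact: cvg_cst.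
Qed.

Lemma has_right_derivD f g x l m :
  has_right_deriv f x l -> has_right_deriv g x m ->
  has_right_deriv (fun y => f y + g y) x (l + m).
Proof.
rewrite /has_right_deriv => Hf Hg.
have H : (f (x + h) - f x) / h + (g (x + h) - g x) / h @[h --> 0^'+] --> l + m.
  exact: cvgD.
apply: cvg_trans H; apply: near_eq_cvg; apply: nearW => h /=.
by rewrite -mulrDl; congr (_ / _); ring.
Qed.

Lemma has_right_deriv_cvg f x l : has_right_deriv f x l ->
  f (x + h) @[h --> 0^'+] --> f x.
Proof.
rewrite /has_right_deriv => Hf.
have h0 : h @[h --> (0 : R)^'+] --> (0 : R).
  exact: (@cvg_at_right_filter R R id 0 0 cvg_id).
have H : f x + (f (x + h) - f x) / h * h @[h --> 0^'+] --> f x + l * 0.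
  by apply: cvgD; [exact: cvg_cst|exact: cvgM].
rewrite mulr0 addr0 in H; apply: cvg_trans H; apply: near_eq_cvg.
near=> h => /=.
by rewrite divfK ?subrKC// gt_eqF.
Unshelve. all: by end_near. Qed.

Lemma has_right_derivM f g x l m :
  has_right_deriv f x l -> has_right_deriv g x m ->
  has_right_deriv (fun y => f y * g y) x (l * g x + f x * m).
Proof.
rewrite /has_right_deriv => Hf Hg.
have H : (f (x + h) - f x) / h * g (x + h) + f x * ((g (x + h) - g x) / h)
    @[h --> 0^'+] --> l * g x + f x * m.
  apply: cvgD; apply: cvgM => //; last exact: cvg_cst.
  exact: has_right_deriv_cvg Hg.
by apply: cvg_trans H; apply: near_eq_cvg; apply: nearW => h /=; ring.
Qed.

Lemma has_right_derivB f g x l m :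
  has_right_deriv f x l -> has_right_deriv g x m ->
  has_right_deriv (fun y => f y - g y) x (l - m).
Proof.
rewrite /has_right_deriv => Hf Hg.
have H : (f (x + h) - f x) / h - (g (x + h) - g x) / h @[h --> 0^'+] --> l - m.
  exact: cvgB.
apply: cvg_trans H; apply: near_eq_cvg; apply: nearW => h /=.
by rewrite -mulrBl; congr (_ / _); ring.
Qed.

Lemma has_right_deriv_derive f x l : is_derive x 1 f l -> has_right_deriv f x l.
Proof.
move=> [df <-].
have sub : (0 : R)^'+ `=>` (0 : R)^'.
  move=> A [e /= e0 He]; exists e => // h he h0.
  by apply: He => //=; rewrite gt_eqF.
have df' : h^-1 *: (f (h *: 1 + x) - f x) @[h --> (0 : R)^'] --> 'D_1 f x by [].
have H : h^-1 *: (f (h *: 1 + x) - f x) @[h --> (0 : R)^'+] --> 'D_1 f x.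
  by move=> A /df' /sub.
apply: cvg_trans H; apply: near_eq_cvg; apply: nearW => h /=.
by rewrite [h%:A]mulr1 (addrC h) [RHS]mulrC.
Qed.

Lemma has_right_deriv_expR c x :
  has_right_deriv (fun y => expR (c * y)) x (c * expR (c * x)).
Proof.
apply: has_right_deriv_derive.
have dcx : is_derive x 1 (fun y : R => c * y) c.
  by apply: is_derive_eq; rewrite /GRing.scale /= mulr1.
by have := is_derive1_comp (is_derive_expR (c * x)) dcx; rewrite mulrC.
Qed.

End right_derivatives.

(** * Divergence inequality *)

Section divergence_inequality.
Context {R : realType}.
Implicit Types (a b c d h t s x y : R).
Local Notation mu := (@lebesgue_measure R).
Local Notation lebesgue2 := (@lebesgue_measure R \x @lebesgue_measure R)%E.

Section divergence.
Variables (a b L : R) (P Q : R -> R -> R).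
Hypothesis ab : a < b.
Hypothesis lipP : forall t s x y, `|P t x - P s y| <= L * (`|t - s| + `|x - y|).
Hypothesis lipQ : forall t s x y, `|Q t x - Q s y| <= L * (`|t - s| + `|x - y|).

Let lipP1 x t s : `|P t x - P s x| <= L * `|t - s|.
Proof. by rewrite (le_trans (lipP _ _ _ _))// subrr normr0 addr0. Qed.

Let lipP2 t x y : `|P t x - P t y| <= L * `|x - y|.
Proof. by rewrite (le_trans (lipP _ _ _ _))// subrr normr0 add0r. Qed.

Let lipQ2 t x y : `|Q t x - Q t y| <= L * `|x - y|.
Proof. by rewrite (le_trans (lipQ _ _ _ _))// subrr normr0 add0r. Qed.

Let Do : set (measurableTypeR R * measurableTypeR R) := `]a, b[ `*` `]0, 1[.

Let D1 h t x := (P (t + h) x - P t x) / h.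
Let D2 h t x := (Q t (x + h) - Q t x) / h.

Let mD1 h : measurable_fun [set: measurableTypeR R * measurableTypeR R]
  (fun p => D1 h p.1 p.2).
Proof.
apply: measurable_funM => //; apply: measurable_funB.
  apply: (@measurable_lipschitz2 _ (fun t x => P (t + h) x) L) => t s x y.
  by rewrite (le_trans (lipP _ _ _ _))// opprD addrACA subrr addr0.
exact: measurable_lipschitz2 lipP.
Qed.

Let mD2 h : measurable_fun [set: measurableTypeR R * measurableTypeR R]
  (fun p => D2 h p.1 p.2).
Proof.
apply: measurable_funM => //; apply: measurable_funB.
  apply: (@measurable_lipschitz2 _ (fun t x => Q t (x + h)) L) => t s x y.
  by rewrite (le_trans (lipQ _ _ _ _))// opprD addrACA subrr addr0.
exact: measurable_lipschitz2 lipQ.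
Qed.

Let bD1 h t x : 0 < h -> `|D1 h t x| <= L.
Proof.
move=> h0; rewrite normrM normfV (gtr0_norm h0) ler_pdivrMr//.
by rewrite (le_trans (lipP1 _ _ _))// addrAC subrr add0r gtr0_norm.
Qed.

Let bD2 h t x : 0 < h -> `|D2 h t x| <= L.
Proof.
move=> h0; rewrite normrM normfV (gtr0_norm h0) ler_pdivrMr//.
by rewrite (le_trans (lipQ2 _ _ _))// addrAC subrr add0r gtr0_norm.
Qed.

Let fin_oo c d : (mu `]c, d[ < +oo)%E.
Proof.
by rewrite lebesgue_measure_itv/=; case: ifPn => // _; rewrite -EFinB ltry.
Qed.

Let iD1 h : 0 < h -> lebesgue2.-integrable Do (EFin \o (fun p => D1 h p.1 p.2)).
Proof.
move=> h0; apply: (@bounded_integrable2 _ _ _ (D1 h) L) => // t x.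
exact: bD1.
Qed.

Let iD2 h : 0 < h -> lebesgue2.-integrable Do (EFin \o (fun p => D2 h p.1 p.2)).
Proof.
move=> h0; apply: (@bounded_integrable2 _ _ _ (D2 h) L) => // t x.
exact: bD2.
Qed.

Let cP1 x : continuous (P^~ x).
Proof. by apply: (@continuous_lipschitz1 _ _ L) => t s; exact: lipP1. Qed.

Let cP2 t : continuous (P t).
Proof. by apply: (@continuous_lipschitz1 _ _ L) => x y; exact: lipP2. Qed.

Let cQ2 t : continuous (Q t).
Proof. by apply: (@continuous_lipschitz1 _ _ L) => x y; exact: lipQ2. Qed.

Let c_shift (f : R -> R) h : continuous f ->
  continuous (fun t => (f (t + h) - f t) / h).
Proof.
move=> cf x; apply: cvgMl; apply: cvgB; last exact: cf.
apply: (@continuous_comp _ _ _ (fun t => t + h) f); last exact: cf.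
by apply: continuousD; [exact: cvg_id|exact: cvg_cst].
Qed.

Let intD1 h : 0 < h ->
  \int[mu]_(x in `[0, 1]) P b x - \int[mu]_(x in `[0, 1]) P a x - 2 * L * h <=
  Rintegral lebesgue2 Do (fun p => D1 h p.1 p.2).
Proof.
move=> h0.
rewrite (@Fubini_rectangle_swap _ _ _ (D1 h) L) => // [|t x]; last exact: bD1.
have cPP : continuous (fun x => P b x - P a x).
  by move=> x; apply: cvgB; exact: cP2.
have cPL : continuous (fun x => P b x - P a x - 2 * L * h).
  by move=> x; apply: cvgB; [exact: cPP|exact: cvg_cst].
rewrite (_ : _ - _ = \int[mu]_(x in `]0, 1[) (P b x - P a x - 2 * L * h)).
  apply: le_Rintegral => //.
  - exact: continuous_integrable_itvoo.
  - by apply: (@integrable_Rintegral_fst _ _ _ (D1 h) L) => // t x; exact: bD1.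
  - move=> x _; rewrite Rintegral_itv_cc_oo; last exact: c_shift.
    by apply: integral_difference_quotient => //; exact: ltW.
rewrite Rintegral_itv_cc_oo// RintegralB//; last 2 first.
  exact: continuous_integrable_itv.
  by apply: continuous_integrable_itv => x; exact: cvg_cst.
rewrite RintegralB//; try exact: continuous_integrable_itv.
by rewrite Rintegral_cst_itv// subr0 mulr1.
Qed.

Hypothesis perQ : forall t, a < t < b -> Q t 0 = Q t 1.

Let intD2 h : 0 < h ->
  - (2 * L * h * (b - a)) <= Rintegral lebesgue2 Do (fun p => D2 h p.1 p.2).
Proof.
move=> h0.
rewrite (@Fubini_rectangle _ _ _ (D2 h) L) => // [|t x]; last exact: bD2.
have cc c : continuous (fun _ : R => c : R) by move=> x; exact: cvg_cst.
rewrite -mulNr -(Rintegral_cst_itv _ (ltW ab)) -Rintegral_itv_cc_oo//.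
apply: le_Rintegral => //.
- exact: continuous_integrable_itvoo.
- by apply: (@integrable_Rintegral_snd _ _ _ (D2 h) L) => // t x; exact: bD2.
- move=> t; rewrite /= in_itv/= => tab.
  rewrite Rintegral_itv_cc_oo; last exact: c_shift.
  have := integral_difference_quotient ler01 h0 (lipQ2 t).
  by rewrite perQ// subrr add0r.
Qed.

Hypothesis ae_le0 : {ae lebesgue2, forall p : R * R,
  a < p.1 < b -> 0 < p.2 < 1 -> exists pt qx,
  [/\ has_right_deriv (P^~ p.2) p.1 pt, has_right_deriv (Q p.1) p.2 qx &
      pt + qx <= 0]}.

(* The positive part G of D tends to 0 almost everywhere; this limit is
   measurable for free, unlike P_t + Q_x. *)
Let D h t x := D1 h t x + D2 h t x.
Let G h t x := (D h t x + `|D h t x|) / 2.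

Let mD h : measurable_fun [set: measurableTypeR R * measurableTypeR R]
  (fun p => D h p.1 p.2).
Proof. exact: measurable_funD. Qed.

Let mG h : measurable_fun [set: measurableTypeR R * measurableTypeR R]
  (fun p => G h p.1 p.2).
Proof.
apply: measurable_funM => //; apply: measurable_funD => //.
exact: measurableT_comp.
Qed.

Let bD h t x : 0 < h -> `|D h t x| <= 2 * L.
Proof.
move=> h0; rewrite (le_trans (ler_normD _ _))//.
by have := bD1 t x h0; have := bD2 t x h0; lra.
Qed.

Let bG h t x : 0 < h -> `|G h t x| <= 2 * L.
Proof.
move=> h0; rewrite /G; have := bD t x h0; have := ler_norm (D h t x).
have := lerNnormlW (lexx `|D h t x|).
by move=> H1 H2 H3; rewrite ger0_norm; lra.
Qed.

Let iD h : 0 < h -> lebesgue2.-integrable Do (EFin \o (fun p => D h p.1 p.2)).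
Proof.
move=> h0; apply: (@bounded_integrable2 _ _ _ (D h) (2 * L)) => // t x.
exact: bD.
Qed.

Let iG h : 0 < h -> lebesgue2.-integrable Do (EFin \o (fun p => G h p.1 p.2)).
Proof.
move=> h0; apply: (@bounded_integrable2 _ _ _ (G h) (2 * L)) => // t x.
exact: bG.
Qed.

Let mDo : measurable Do.
Proof. exact: measurableX. Qed.

Let intG_ge h : 0 < h ->
  \int[mu]_(x in `[0, 1]) P b x - \int[mu]_(x in `[0, 1]) P a x
   - 2 * L * (1 + (b - a)) * h <= Rintegral lebesgue2 Do (fun p => G h p.1 p.2).
Proof.
move=> h0.
apply: (@le_trans _ _ (Rintegral lebesgue2 Do (fun p => D h p.1 p.2))).
  rewrite RintegralD//; [|exact: iD1|exact: iD2].
  by have := intD1 h0; have := intD2 h0; lra.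
apply: le_Rintegral => //; [exact: iD|exact: iG|].
move=> p _; rewrite /G.
by have := ler_norm (D h p.1 p.2); lra.
Qed.

Let h_ n : R := n.+1%:R^-1.

Let h_gt0 n : 0 < h_ n. Proof. by rewrite invr_gt0. Qed.

Let cvg_h : h_ n @[n --> \oo] --> (0 : R).
Proof. exact: cvg_harmonic. Qed.

Let cvgG : {ae lebesgue2, forall p : R * R, Do p ->
  (G (h_ n) p.1 p.2)%:E @[n --> \oo] --> 0%E}.
Proof.
apply: (@filterS _ _ (ae_filter_ringOfSetsType lebesgue2) _ _ _ ae_le0).
move=> [t x] /= H [/= tab x01].
have [pt [qx [Hp Hq pq0]]] := H tab x01.
have cD : D (h_ n) t x @[n --> \oo] --> pt + qx.
  apply: cvgD.
    by move/cvg_at_rightP : Hp; apply; split.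
  by move/cvg_at_rightP : Hq; apply; split.
apply: cvg_EFin; first by apply: nearW.
have -> : 0 = (pt + qx + `|pt + qx|) / 2 by rewrite ler0_norm// subrr mul0r.
by apply: cvgMl; apply: cvgD => //; exact: cvg_norm.
Qed.

(** Lipschitz bounds on the whole plane let the difference quotients be taken
    without leaving the domain; divergence_le removes this by extension. *)
Lemma divergence_le_global :
  \int[mu]_(x in `[0, 1]) P b x <= \int[mu]_(x in `[0, 1]) P a x.
Proof.
have mGn n : measurable_fun Do (fun p => (G (h_ n) p.1 p.2)%:E).
  suff : measurable_fun Do (EFin \o (fun p => G (h_ n) p.1 p.2)) by [].
  by apply/measurable_EFinP; apply: measurable_funTS; exact: mG.
have i2L : lebesgue2.-integrable Do (cst (2 * L)%:E).
  by apply: (@bounded_integrable2 _ _ _ (fun _ _ => 2 * L) `|2 * L|).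
have bGn : {ae lebesgue2, forall p n, Do p ->
    (`|(G (h_ n) p.1 p.2)%:E| <= cst (2 * L)%:E p)%E}.
  by apply: aeW => p n _; rewrite lee_fin; exact: bG.
have m0 : measurable_fun Do (cst 0%E : _ -> \bar R) by [].
have [_ _] := dominated_convergence mDo mGn m0 cvgG i2L bGn.
rewrite integral0 => /fine_cvg /= cG.
rewrite -subr_le0; set I := _ - _.
have cI : I - 2 * L * (1 + (b - a)) * h_ n @[n --> \oo] --> I.
  rewrite -[X in _ --> X]subr0; apply: cvgB; first exact: cvg_cst.
  rewrite -(mulr0 (2 * L * (1 + (b - a)))).
  by apply: cvgMr.
apply: (ler_cvg_to cI cG).
by apply: nearW => n; exact: intG_ge.
Qed.

End divergence.

Definition clamp c d x : R := Num.max c (Num.min x d).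

Lemma clamp_id c d x : c <= x <= d -> clamp c d x = x.
Proof. by move=> /andP[cx xd]; rewrite /clamp min_l// max_r. Qed.

Lemma clamp_itv c d x : c <= d -> c <= clamp c d x <= d.
Proof.
by move=> cd; rewrite /clamp le_max lexx/= ge_max cd ge_min lexx orbT.
Qed.

Lemma clamp_lip c d x y : c <= d -> `|clamp c d x - clamp c d y| <= `|x - y|.
Proof.
wlog xy : x y / y <= x.
  move=> H cd; have [|/ltW] := leP y x; first by move/H; exact.
  by move/H => /(_ cd); rewrite distrC (distrC x).
move=> cd; rewrite (ger0_norm (_ : 0 <= x - y)) ?subr_ge0//.
rewrite /clamp ler_norml; case: (leP x d) => ?; case: (leP y d) => ?;
  do 2 ?case: (leP c) => ?; apply/andP; split; lra.
Qed.

(** Clamping the arguments extends P and Q to the plane with the same Lipschitz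
    constant, and changes no right derivative at an interior point. *)
Lemma divergence_le (a b L : R) (P Q : R -> R -> R) : a < b ->
  (forall t s x y, a <= t <= b -> a <= s <= b -> 0 <= x <= 1 -> 0 <= y <= 1 ->
    `|P t x - P s y| <= L * (`|t - s| + `|x - y|)) ->
  (forall t s x y, a <= t <= b -> a <= s <= b -> 0 <= x <= 1 -> 0 <= y <= 1 ->
    `|Q t x - Q s y| <= L * (`|t - s| + `|x - y|)) ->
  (forall t, a < t < b -> Q t 0 = Q t 1) ->
  {ae lebesgue2, forall p : R * R, a < p.1 < b -> 0 < p.2 < 1 -> exists pt qx,
    [/\ has_right_deriv (P^~ p.2) p.1 pt, has_right_deriv (Q p.1) p.2 qx &
        pt + qx <= 0]} ->
  \int[mu]_(x in `[0, 1]) P b x <= \int[mu]_(x in `[0, 1]) P a x.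
Proof.
move=> ab lipP lipQ perQ aePQ.
have L0 : 0 <= L.
  have := lipP b a 0 0; rewrite !lexx ltW// ler01 subrr normr0 addr0.
  move=> /(_ isT isT isT isT) /(le_trans (normr_ge0 _)).
  by rewrite pmulr_lge0// gtr0_norm subr_gt0.
pose ext (F : R -> R -> R) t x := F (clamp a b t) (clamp 0 1 x).
have lip_ext (F : R -> R -> R) :
  (forall t s x y, a <= t <= b -> a <= s <= b -> 0 <= x <= 1 -> 0 <= y <= 1 ->
    `|F t x - F s y| <= L * (`|t - s| + `|x - y|)) ->
   forall t s x y, `|ext F t x - ext F s y| <= L * (`|t - s| + `|x - y|).
  move=> lipF t s x y; apply: (le_trans (lipF _ _ _ _ _ _ _ _)).
  1-4: by apply: clamp_itv => //; exact: ltW.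
  by rewrite ler_wpM2l// lerD// clamp_lip// ltW.
have extE (F : R -> R -> R) t x : a <= t <= b -> 0 <= x <= 1 ->
    ext F t x = F t x.
  by move=> tab x01; rewrite /ext !clamp_id.
have := divergence_le_global ab (lip_ext _ lipP) (lip_ext _ lipQ) _ _.
rewrite (@eq_Rintegral _ _ _ mu _ (P b) (ext P b)); last first.
  by move=> x; rewrite inE/= in_itv/= => x01; rewrite extE// lexx ltW.
rewrite (@eq_Rintegral _ _ _ mu _ (P a) (ext P a)); last first.
  by move=> x; rewrite inE/= in_itv/= => x01; rewrite extE// lexx ltW.
apply.
  move=> t /[dup] tab /andP[/ltW ta /ltW tb].
  by rewrite !extE ?lexx ?ler01 ?ta ?tb// perQ.
apply: (@filterS _ _ (ae_filter_ringOfSetsType lebesgue2) _ _ _ aePQ).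
move=> [t x] /= H tab x01.
have [pt [qx [Hp Hq pq]]] := H tab x01.
move: tab x01 => /andP[ta tb] /andP[x0 x1].
exists pt, qx; split => //.
  apply: has_right_deriv_eq Hp; first exact: tb.
  by move=> s /andP[ts sb]; rewrite extE//; apply/andP; split; lra.
apply: has_right_deriv_eq Hq; first exact: x1.
by move=> s /andP[ts sb]; rewrite extE//; apply/andP; split; lra.
Qed.

End divergence_inequality.

(** * Bounded Lipschitz functions *)

Section bounded_lipschitz_functions.
Context {R : realType}.
Implicit Types (c t s x y T : R) (F G u : R -> R -> R).
Local Notation mu := (@lebesgue_measure R).

(** Boundedness is included, with the same constant, to make the class closed
    under products. *)
Definition bounded_lipschitz T F : Prop :=
  exists2 C, forall t x, 0 <= t <= T -> 0 <= x <= 1 -> `|F t x| <= C &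
  forall t s x y, 0 <= t <= T -> 0 <= s <= T -> 0 <= x <= 1 -> 0 <= y <= 1 ->
    `|F t x - F s y| <= C * (`|t - s| + `|x - y|).

Lemma bounded_lipschitzD T F G :
  bounded_lipschitz T F -> bounded_lipschitz T G ->
  bounded_lipschitz T (fun t x => F t x + G t x).
Proof.
move=> [C bF lF] [C' bG lG]; exists (C + C').
  by move=> t x tT x1; rewrite (le_trans (ler_normD _ _))// lerD ?bF ?bG.
move=> t s x y tT sT x1 y1; rewrite opprD addrACA (le_trans (ler_normD _ _))//.
by rewrite mulrDl lerD ?lF ?lG.
Qed.

Lemma bounded_lipschitzM T F G :
  bounded_lipschitz T F -> bounded_lipschitz T G ->
  bounded_lipschitz T (fun t x => F t x * G t x).
Proof.
move=> [C bF lF] [C' bG lG].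
have [T0|T0] := ltP T 0.
  exists 0; first by move=> t x /andP[/le_trans] /[apply]; rewrite leNgt T0.
  by move=> t s x y /andP[/le_trans] /[apply]; rewrite leNgt T0.
have C0 : 0 <= C by rewrite (le_trans _ (bF 0 0 _ _))// lexx ?T0 ?ler01.
have C0' : 0 <= C' by rewrite (le_trans _ (bG 0 0 _ _))// lexx ?T0 ?ler01.
exists (2 * (C * C')).
  move=> t x tT x1; rewrite normrM (@le_trans _ _ (C * C'))//.
    by rewrite ler_pM// ?bF ?bG.
  by have := mulr_ge0 C0 C0'; lra.
move=> t s x y tT sT x1 y1.
rewrite (_ : _ - _ = F t x * (G t x - G s y) + (F t x - F s y) * G s y);
  last by ring.
rewrite (le_trans (ler_normD _ _))// !normrM.
have H1 : `|F t x| * `|G t x - G s y| <= C * (C' * (`|t - s| + `|x - y|)).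
  by rewrite ler_pM// ?bF ?lG.
have H2 : `|F t x - F s y| * `|G s y| <= C * (`|t - s| + `|x - y|) * C'.
  by rewrite ler_pM// ?bG ?lF.
by apply: (le_trans (lerD H1 H2)); lra.
Qed.

Lemma bounded_lipschitz_cst T c : bounded_lipschitz T (fun _ _ => c).
Proof.
exists `|c| => // t s x y _ _ _ _.
by rewrite subrr normr0 mulr_ge0// addr_ge0.
Qed.

Lemma bounded_lipschitz_expR T c :
  bounded_lipschitz T (fun t _ => expR (c * t)).
Proof.
have [T0|T0] := ltP T 0.
  exists 0; first by move=> t x /andP[/le_trans] /[apply]; rewrite leNgt T0.
  by move=> t s x y /andP[/le_trans] /[apply]; rewrite leNgt T0.
have bnd t : 0 <= t <= T -> expR (c * t) <= expR (`|c| * T).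
  move=> /andP[t0 tT]; rewrite ler_expR (le_trans (ler_norm _))//.
  by rewrite normrM (ger0_norm t0) ler_wpM2l.
have C1 : 1 <= 1 + `|c| by rewrite lerDl.
have lip t s : 0 <= t <= T -> expR (c * t) - expR (c * s) <=
    expR (`|c| * T) * `|c| * `|t - s|.
  move=> tT.
  rewrite -mulrA -normrM.
  (* expR u - expR v = expR u * (1 - expR (v - u)) <= expR u * (u - v) *)
  have H := expR_ge1Dx (c * s - c * t).
  have -> : expR (c * t) - expR (c * s) =
      expR (c * t) * (1 - expR (c * s - c * t)).
    by rewrite mulrBr mulr1 -expRD subrKC.
  rewrite (@le_trans _ _ (expR (c * t) * `|c * (t - s)|))//.
    rewrite ler_wpM2l ?expR_ge0//; have := ler_norm (c * (t - s)); lra.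
  by rewrite ler_wpM2r// bnd.
exists (expR (`|c| * T) * (1 + `|c|)).
  move=> t x tT _; rewrite ger0_norm ?expR_ge0// (le_trans (bnd _ tT))//.
  by rewrite ler_peMr ?expR_ge0.
move=> t s x y tT sT _ _.
rewrite (@le_trans _ _ (expR (`|c| * T) * `|c| * `|t - s|))//.
  by rewrite ler_norml lip// andbT lerNl opprB distrC lip.
rewrite ler_pM// ?mulr_ge0 ?expR_ge0//; last by rewrite lerDl.
by rewrite ler_wpM2l ?expR_ge0// lerDr.
Qed.

Lemma lipschitz_bounded_lipschitz T u :
  [lipschitz u p.1 p.2 | p in cylinder T] -> bounded_lipschitz T u.
Proof.
move=> /pinfty_ex_gt0[M M0 HM].
have [T0|T0] := ltP T 0.
  exists 0; first by move=> t x /andP[/le_trans] /[apply]; rewrite leNgt T0.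
  by move=> t s x y /andP[/le_trans] /[apply]; rewrite leNgt T0.
have lip t s x y : 0 <= t <= T -> 0 <= s <= T -> 0 <= x <= 1 -> 0 <= y <= 1 ->
    `|u t x - u s y| <= M * (`|t - s| + `|x - y|).
  move=> tT sT x1 y1; have /= := HM ((t, x), (s, y)).
  move=> /(_ _)/le_trans; apply.
    by split; split; rewrite /= in_itv.
  rewrite ler_wpM2l ?(ltW M0)// prod_normE /= ge_max.
  by rewrite lerDl lerDr !normr_ge0.
exists (M + (`|u 0 0| + M * (T + 1))).
  move=> t x tT x1; have := lip t 0 x 0 tT; rewrite !lexx T0 ler01 x1 !subr0.
  move=> /(_ isT isT isT) H.
  have -> : u t x = (u t x - u 0 0) + u 0 0 by rewrite subrK.
  rewrite (le_trans (ler_normD _ _))//.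
  have H2 : M * (`|t| + `|x|) <= M * (T + 1).
    rewrite ler_wpM2l ?(ltW M0)// lerD//.
      by case/andP: tT => t0 tT; rewrite ger0_norm.
    by case/andP: x1 => x0 x1; rewrite ger0_norm.
  by move: H H2 M0; clear; lra.
move=> t s x y tT sT x1 y1; rewrite (le_trans (lip _ _ _ _ tT sT x1 y1))//.
rewrite ler_wpM2r ?addr_ge0// lerDl addr_ge0// mulr_ge0 ?addr_ge0//.
exact: ltW.
Qed.

Lemma bounded_lipschitz_integrable T F t : 0 <= t <= T ->
  bounded_lipschitz T F -> mu.-integrable `[0, 1] (EFin \o F t).
Proof.
move=> tT [C bF lF].
have C0 : 0 <= C by rewrite (le_trans _ (bF t 0 _ _))// lexx ler01.
have cF : continuous (fun x => F t (clamp 0 1 x)).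
  apply: (@continuous_lipschitz1 _ _ C) => x y.
  apply: (le_trans (lF _ _ _ _ _ _ _ _)) => //; try exact: clamp_itv.
  by rewrite subrr normr0 add0r ler_wpM2l// clamp_lip.
have := continuous_integrable_itv 0 1 cF.
apply: eq_integrable => // x; rewrite inE/= in_itv/= => x1.
by rewrite clamp_id.
Qed.

End bounded_lipschitz_functions.

(** * Energy estimates *)

Section energy_estimates.
Context {R : realType}.
Implicit Types (h t s x y l T lam eps : R).
Local Notation mu := (@lebesgue_measure R).
Local Notation lebesgue2 := (@lebesgue_measure R \x @lebesgue_measure R)%E.

Definition energy (w : R -> R -> R) t : R :=
  \int[mu]_(x in `[0, 1]) (w t x * w t x).

Section energy_estimate.
Variables (T a b c M : R) (src o v : R -> R -> R).
Hypotheses (a0 : 0 <= a) (ab : a <= b) (bT : b <= T).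
Hypothesis o_sol : burgers_solution T (fun _ _ => 0) o.
Hypothesis v_sol : burgers_solution T src v.
Hypothesis srcE : forall t x, a < t < b -> 0 <= x <= 1 ->
  src t x = c * (v t x - o t x).
Hypothesis o_dx : forall t x l, t \in `[0, T] -> x \in `[0, 1] ->
  is_dx o t x l -> `|l| <= M.

Let w t x := v t x - o t x.

Let blv : bounded_lipschitz T v.
Proof. by case: v_sol => /lipschitz_bounded_lipschitz. Qed.

Let blo : bounded_lipschitz T o.
Proof. by case: o_sol => /lipschitz_bounded_lipschitz. Qed.

Let blw : bounded_lipschitz T w.
Proof.
have := bounded_lipschitzD blv
  (bounded_lipschitzM (bounded_lipschitz_cst T (-1)) blo).
rewrite /w (_ : (fun t x => _ + _) = (fun t x => v t x - o t x))//.
by apply/funext => t; apply/funext => x; rewrite mulN1r.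
Qed.

Lemma error_square_integrable t : 0 <= t <= T ->
  mu.-integrable `[0, 1] (EFin \o (fun x => w t x * w t x)).
Proof.
move=> tT.
apply: (@bounded_lipschitz_integrable _ T (fun t x => w t x * w t x)) => //.
exact: bounded_lipschitzM.
Qed.

(** The sign eps turns one monotonicity statement into both the upper bound
    (eps = 1) and the lower bound (eps = -1) on the growth of the energy. *)
Lemma weighted_energy_le eps lam :
  (forall l, `|l| <= M -> eps * (2 * c - lam - l) <= 0) ->
  eps * expR (- lam * b) * energy w b <= eps * expR (- lam * a) * energy w a.
Proof.
move=> eps_le0.
move: ab; rewrite le_eqVlt => /predU1P[<-//|ltab].
pose e t x := eps * expR (- lam * t).
pose P t x := e t x * (w t x * w t x).
pose Q t x :=
  e t x * (2 / 3 * (w t x * (w t x * w t x)) + o t x * (w t x * w t x)).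
have ble : bounded_lipschitz T e.
  apply: bounded_lipschitzM; first exact: bounded_lipschitz_cst.
  exact: bounded_lipschitz_expR.
have blP : bounded_lipschitz T P by do !apply: bounded_lipschitzM => //.
have blQ : bounded_lipschitz T Q.
  apply: bounded_lipschitzM => //; apply: bounded_lipschitzD.
    apply: bounded_lipschitzM; first exact: bounded_lipschitz_cst.
    by do !apply: bounded_lipschitzM.
  by do !apply: bounded_lipschitzM.
have [CP _ lipP] := blP; have [CQ _ lipQ] := blQ.
have inT t : a <= t <= b -> 0 <= t <= T.
  by move=> /andP[at_ tb]; rewrite (le_trans a0)// (le_trans tb).
pose C := Num.max CP CQ.
have EE t : a <= t <= b ->
    \int[mu]_(x in `[0, 1]) P t x = eps * expR (- lam * t) * energy w t.
  move=> tab; rewrite RintegralZl//.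
  exact: error_square_integrable (inT _ tab).
rewrite -!EE ?lexx ?(ltW ltab)//; apply: (@divergence_le _ a b C P Q ltab).
- move=> t s x y /inT tT /inT sT x1 y1.
  apply: (le_trans (lipP _ _ _ _ tT sT x1 y1)).
  by rewrite ler_wpM2r ?addr_ge0// /C le_max lexx.
- move=> t s x y /inT tT /inT sT x1 y1.
  apply: (le_trans (lipQ _ _ _ _ tT sT x1 y1)).
  by rewrite ler_wpM2r ?addr_ge0// /C le_max lexx orbT.
- move=> t /andP[/ltW at_ /ltW tb].
  have tT : t \in `[0, T] by rewrite in_itv/= inT// at_.
  case: v_sol => _ /(_ t tT) [per_v _] _.
  case: o_sol => _ /(_ t tT) [per_o _] _.
  by rewrite /Q /w /e per_v per_o.
case: v_sol => _ _ aev; case: o_sol => _ _ aeo.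
apply: (@filterS2 _ _ (ae_filter_ringOfSetsType lebesgue2) _ _ _ _ aev aeo).
move=> [t x] /= Hv Ho tab x01.
have ht := @has_right_deriv_expR _ (- lam) t.
have tT' : 0 <= t <= T by apply: inT; case/andP: tab => /ltW -> /ltW ->.
have x1' : 0 <= x <= 1 by case/andP: x01 => /ltW -> /ltW ->.
have cyl : cylinder T (t, x) by split; rewrite /= in_itv.
have [vt [vx [dvt dvx ev]]] := Hv cyl.
have [ot [ox [dot dox eo]]] := Ho cyl.
have tT : t < T by case/andP: tab => _ tb; exact: lt_le_trans bT.
have t0 : 0 <= t by case/andP: tT'.
have x1 : x < 1 by case/andP: x01.
have x0 : 0 <= x by case/andP: x1'.
have oxM : `|ox| <= M by apply: o_dx dox; rewrite in_itv.
have wt := has_right_derivB (has_right_deriv_within t0 tT dvt)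
  (has_right_deriv_within t0 tT dot).
have rx := has_right_deriv_within x0 x1 dox.
have wx := has_right_derivB (has_right_deriv_within x0 x1 dvx) rx.
have ww_t := has_right_derivM wt wt.
have ww_x := has_right_derivM wx wx.
have Pt := has_right_derivM
  (has_right_derivM (has_right_deriv_cst eps t) ht) ww_t.
have Qx := has_right_derivM (has_right_deriv_cst (e t x) x) (has_right_derivD
  (has_right_derivM (has_right_deriv_cst (2 / 3) x) (has_right_derivM wx ww_x))
  (has_right_derivM rx ww_x)).
do 2 eexists; split; [exact: Pt|exact: Qx|].
rewrite srcE// in ev.
have vtE : vt = c * (v t x - o t x) - v t x * vx by rewrite -ev addrK.
have otE : ot = - (o t x * ox) by apply/eqP; rewrite -subr_eq0 opprK eo.
(* P_t + Q_x = eps e^(- lam t) w^2 (2 c - lam - o_x): all terms containing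
   v_x cancel. *)
rewrite /= {}vtE {}otE /e.
rewrite [leLHS](_ : _ =
  expR (- lam * t) * (w t x * w t x) * (eps * (2 * c - lam - ox))).
  by rewrite mulr_ge0_le0 ?eps_le0// mulr_ge0 ?expR_ge0// -expr2 sqr_ge0.
by rewrite /w; field.
Qed.

Lemma energy_upper :
  energy w b <= expR ((2 * c + M) * (b - a)) * energy w a.
Proof.
have := @weighted_energy_le 1 (2 * c + M).
rewrite !mul1r => H.
rewrite -(@ler_pM2l _ (expR (- (2 * c + M) * b))) ?expR_gt0//.
rewrite mulrA -expRD (_ : - (2 * c + M) * b + _ = - (2 * c + M) * a);
  last by ring.
apply: H => l; rewrite ler_norml; lra.
Qed.

Lemma energy_lower :
  expR ((2 * c - M) * (b - a)) * energy w a <= energy w b.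
Proof.
have := @weighted_energy_le (-1) (2 * c - M).
rewrite !mulN1r !mulNr lerN2 => H.
rewrite -(@ler_pM2l _ (expR (- ((2 * c - M) * b)))) ?expR_gt0//.
rewrite mulrA -expRD (_ : - ((2 * c - M) * b) + _ = - ((2 * c - M) * a));
  last by ring.
apply: H => l; rewrite ler_norml; lra.
Qed.

End energy_estimate.

Lemma L2norm_sqrt (f : R -> R) :
  mu.-integrable `[0, 1] (EFin \o (fun x => f x * f x)) ->
  L2norm f = (Num.sqrt (\int[mu]_(x in `[0, 1]) (f x * f x)))%:E.
Proof.
move=> intf; rewrite /L2norm unlock poweR12_sqrt; last first.
  by apply: integral_ge0 => x _; exact: poweR_ge0.
rewrite (_ : (\int[_]_x _)%E =
  (\int[mu]_(x in `[0%R, 1%R]) (f x * f x)%:E)%E); last first.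
  rewrite [RHS]integral_mkcond; apply: eq_integral => x _.
  rewrite /= !patchE; case: ifPn => _ /=.
    by rewrite powR_mulrn// -expr2 real_normK ?num_real.
  by rewrite normr0 powR0.
rewrite /Rintegral.
by rewrite -[in LHS](fineK (integrable_fin_num _ intf)).
Qed.

Lemma L2norm_le (w w' : R -> R -> R) t s k :
   mu.-integrable `[0, 1] (EFin \o (fun x => w t x * w t x)) ->
   mu.-integrable `[0, 1] (EFin \o (fun x => w' s x * w' s x)) ->
   energy w t <= expR (2 * k) * energy w' s ->
   (L2norm (w t) <= (expR k)%:E * L2norm (w' s))%E.
Proof.
move=> iw iw' H; rewrite !L2norm_sqrt// -EFinM lee_fin.
have -> : expR k = Num.sqrt (expR (2 * k)).
  by rewrite mulrC expRM_natr sqrtr_sqr ger0_norm// expR_ge0.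
by rewrite -sqrtrM ?expR_ge0// ler_wsqrtr.
Qed.

End energy_estimates.

Theorem theorem4 (R : realType) (T kappa M : R) (K : R -> R -> R)
    (uobs0 u0 : R -> R) (uobs u util : R -> R -> R)
    (T_gt0 : 0 < T) (kappa_gt0 : 0 < kappa) (M_gt0 : 0 < M)
    (K_ge0 : forall t x : R, t \in `[0, T] -> x \in `[0, 1] -> 0 <= K t x)
    (uobs_sol : burgers_solution T (fun _ _ => 0) uobs)
    (uobs_init : forall x : R, x \in `[0, 1] -> uobs 0 x = uobs0 x)
    (u_sol : burgers_solution T (fun t x => - K t x * (u t x - uobs t x)) u)
    (u_init : forall x : R, x \in `[0, 1] -> u 0 x = u0 x)
    (util_sol : burgers_solution T
       (fun t x => kappa * K t x * (util t x - uobs t x)) util)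
    (util_final : forall x : R, x \in `[0, 1] -> util T x = u T x)
    (uobs_W1infty : W1infty T uobs)
    (uobs_dx_le : forall t x l : R, t \in `[0, T] -> x \in `[0, 1] ->
       is_dx uobs t x l -> `|l| <= M) :
  let w := fun t x => u t x - uobs t x in
  let wtil := fun t x => util t x - uobs t x in
  (forall k : R,
     (forall t x : R, t \in `[0, T] -> x \in `[0, 1] -> K t x = k) ->
     forall t : R, t \in `[0, T] ->
       (L2norm (wtil t) <=
        (expR ((- k - kappa * k + M) * (T - t)))%:E * L2norm (w t))%E) /\
  (forall k t1 t2 : R, 0 < k -> 0 <= t1 -> t1 < t2 -> t2 <= T ->
     (forall t x : R, t \in `[0, T] -> x \in `[0, 1] ->
        K t x = k * \1_(`[t1, t2]) t) ->
     (L2norm (wtil 0%R) <=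
      (expR ((- k - kappa * k) * (t2 - t1) + M * T))%:E * L2norm (w 0%R))%E).
Proof.
move=> w wtil.
have T0 : 0 <= T by exact: ltW.
have wwi v src : burgers_solution T src v -> forall t, 0 <= t <= T ->
    (@lebesgue_measure R).-integrable `[0, 1]
      (EFin \o (fun x => (v t x - uobs t x) * (v t x - uobs t x))).
  move=> v_sol t tT.
  exact: (error_square_integrable uobs_sol v_sol tT).
have energyT : energy wtil T = energy w T.
  apply: eq_Rintegral => x; rewrite inE/= => x01.
  by rewrite /w /wtil util_final.
split.
- move=> k Kk t; rewrite in_itv/= => /andP[t0 tT].
  have tT' : 0 <= t <= T by rewrite t0.
  have srcu s x : t < s < T -> 0 <= x <= 1 ->
      - K s x * (u s x - uobs s x) = - k * (u s x - uobs s x).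
    move=> /andP[ts sT] x01.
    by rewrite Kk// in_itv/= (ltW sT) (le_trans t0) ?ltW.
  have srcutil s x : t < s < T -> 0 <= x <= 1 ->
      kappa * K s x * (util s x - uobs s x) = kappa * k * (util s x - uobs s x).
    move=> /andP[ts sT] x01.
    by rewrite Kk// in_itv/= (ltW sT) (le_trans t0) ?ltW.
  have Ew := energy_upper t0 tT (lexx T) uobs_sol u_sol srcu uobs_dx_le.
  have Eutil :=
    energy_lower t0 tT (lexx T) uobs_sol util_sol srcutil uobs_dx_le.
  apply: L2norm_le; [exact: wwi util_sol _ tT'|exact: wwi u_sol _ tT'|].
  rewrite -(@ler_pM2l _ (expR ((2 * (kappa * k) - M) * (T - t)))) ?expR_gt0//.
  rewrite (le_trans Eutil)// -/wtil energyT (le_trans Ew)// [leRHS]mulrA -expRD.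
  by rewrite le_eqVlt; apply/orP; left; apply/eqP; congr (expR _ * _); ring.
move=> k t1 t2 k0 t10 t12 t2T KE.
have t20 : 0 <= t2 by rewrite (le_trans t10)// ltW.
have t1T : t1 <= T by rewrite (le_trans _ t2T)// ltW.
have Kin s x : t1 < s < t2 -> 0 <= x <= 1 -> K s x = k.
  move=> /andP[ts st] x01.
  have sT : s \in `[0, T] by rewrite in_itv/=; apply/andP; split; lra.
  by rewrite KE// indicE mem_set ?mulr1//= in_itv/= !ltW.
have Kout s x : 0 <= s <= T -> (s < t1) || (t2 < s) -> 0 <= x <= 1 -> K s x = 0.
  move=> sT st x01; rewrite KE// ?in_itv//= indicE memNset ?mulr0//=.
  rewrite in_itv/= => /andP[t1s st2].
  by move: st; rewrite !ltNge t1s st2.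
have Ew : energy w T <= expR (- 2 * k * (t2 - t1) + M * T) * energy w 0.
  have E1 : energy w t1 <= expR ((2 * 0 + M) * (t1 - 0)) * energy w 0.
    apply: (energy_upper (lexx 0) t10 t1T uobs_sol u_sol _ uobs_dx_le).
    move=> s x /andP[s0 st] x01; rewrite Kout// ?oppr0 ?mul0r ?st//.
    by rewrite (ltW s0) (le_trans (ltW st)).
  have E2 : energy w t2 <= expR ((2 * - k + M) * (t2 - t1)) * energy w t1.
    apply: (energy_upper t10 (ltW t12) t2T uobs_sol u_sol _ uobs_dx_le).
    by move=> s x st x01; rewrite Kin.
  have E3 : energy w T <= expR ((2 * 0 + M) * (T - t2)) * energy w t2.
    apply: (energy_upper t20 t2T (lexx T) uobs_sol u_sol _ uobs_dx_le).
    move=> s x /andP[ts sT] x01; rewrite Kout// ?oppr0 ?mul0r ?ts ?orbT//.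
    by rewrite (ltW sT) (le_trans t20 (ltW ts)).
  rewrite (le_trans E3)//.
  rewrite (le_trans (ler_wpM2l (expR_ge0 _) E2))// [leLHS]mulrA -expRD.
  rewrite (le_trans (ler_wpM2l (expR_ge0 _) E1))// [leLHS]mulrA -expRD.
  by rewrite le_eqVlt; apply/orP; left; apply/eqP; congr (expR _ * _); ring.
have Eutil : expR (2 * (kappa * k) * (t2 - t1) - M * T) * energy wtil 0 <=
    energy wtil T.
  have E1 : expR ((2 * 0 - M) * (t1 - 0)) * energy wtil 0 <= energy wtil t1.
    apply: (energy_lower (lexx 0) t10 t1T uobs_sol util_sol _ uobs_dx_le).
    move=> s x /andP[s0 st] x01; rewrite Kout// ?mulr0 ?mul0r ?st//.
    by rewrite (ltW s0) (le_trans (ltW st)).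
  have E2 : expR ((2 * (kappa * k) - M) * (t2 - t1)) * energy wtil t1 <=
      energy wtil t2.
    apply: (energy_lower t10 (ltW t12) t2T uobs_sol util_sol _ uobs_dx_le).
    by move=> s x st x01; rewrite Kin.
  have E3 : expR ((2 * 0 - M) * (T - t2)) * energy wtil t2 <= energy wtil T.
    apply: (energy_lower t20 t2T (lexx T) uobs_sol util_sol _ uobs_dx_le).
    move=> s x /andP[ts sT] x01; rewrite Kout// ?mulr0 ?mul0r ?ts ?orbT//.
    by rewrite (ltW sT) (le_trans t20 (ltW ts)).
  apply: le_trans E3; apply: le_trans (ler_wpM2l (expR_ge0 _) E2).
  rewrite [leRHS]mulrA -expRD; apply: le_trans (ler_wpM2l (expR_ge0 _) E1).
  rewrite [leRHS]mulrA -expRD.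
  by rewrite le_eqVlt; apply/orP; left; apply/eqP; congr (expR _ * _); ring.
have z0 : (0 : R) <= 0 <= T by apply/andP; split.
apply: L2norm_le; [exact: wwi util_sol _ z0|exact: wwi u_sol _ z0|].
rewrite -(@ler_pM2l _ (expR (2 * (kappa * k) * (t2 - t1) - M * T))) ?expR_gt0//.
rewrite (le_trans Eutil)// energyT (le_trans Ew)// [leRHS]mulrA -expRD.
by rewrite le_eqVlt; apply/orP; left; apply/eqP; congr (expR _ * _); ring.
Qed.
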